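(* There exists an absolute constant $C\in(0,\infty)$ such that the following holds. Let $\mathcal{S}=\bigcup_j\mathcal{S}_j$ be a countable union of disjoint $(\varepsilon_j,d_j)$-configurations $\mathcal{S}_j$ in $\mathbb{T}^\omega$, with $\varepsilon_j\in(0,\frac12]$ and $d_j\in\mathbb{N}$. Assume that for some $p_0\in(1,2]$ we have $A_{p_0}(\mathcal{S}):=\sup_j\varepsilon_j d_j^{1/p_0}=1$. Then, for $q_0:=\frac{p_0}{p_0-1}$, $$\|\mathcal{M}_{\mathcal{S}}\|_{L^{p_0}\to L^{p_0,\infty}}\le C\,\frac{q_0}{\log(q_0)} .$$
   Context: $\mathbb{N}=\{1,2,\dots\}$; $\log$ is the natural logarithm. $\mathbb{T}^\omega$ is the product of countably many copies of $\mathbb{T}=\mathbb{R}/\mathbb{Z}$ (identified with $[0,1)$), with normalized Haar measure $dx$; $|E|$ denotes the measure of $E$. $L^p = L^p(\mathbb{T}^\omega)$. Sets $V_m$ and subgroups $H_m$, $m\in\mathbb{N}$. To each $m$ assign a finite list of positive integers (exponents) $(a_1,\dots,a_N)$ as follows. If $m=1$ the list is $(1)$. If $m=n^2+j$ with $n\ge 1$ and $1\le j\le n$, then $N=n+1$, $a_1=\dots=a_n=n$, $a_{n+1}=j$. If $m=n^2+n+j$ with $n\ge1$ and $1\le j\le n+1$, then $N=n+1$, $a_i=n+1$ for $i\le j$ and $a_i=n$ for $j<i\le n+1$. Put $V_m=\prod_{i=1}^N(0,2^{-a_i})\times\mathbb{T}\times\mathbb{T}\times\cdots$ and $H_m=\prod_{i=1}^N\{0,2^{-a_i},\dots,(2^{a_i}-1)2^{-a_i}\}\times\{0\}\times\{0\}\times\cdots$.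 The first $N$ coordinates are called the nonfree coordinates of $V_m$. (For example $V_2=(0,\frac12)^2\times\mathbb{T}\times\cdots$, $V_3=(0,\frac14)\times(0,\frac12)\times\mathbb{T}\times\cdots$, $V_4=(0,\frac14)^2\times\mathbb{T}\times\cdots$, $V_5=(0,\frac14)^2\times(0,\frac12)\times\mathbb{T}\times\cdots$.) Let $\mathcal{R}_0=\{t+V_m: m\in\mathbb{N},\ t\in H_m\}$. $(\varepsilon,d)$-configuration. Let $\varepsilon\in(0,\frac12]$, $d\in\mathbb{N}$, and let $Q=t+V_m\in\mathcal{R}_0$ ($t\in H_m$) with $m$ so large that $V_m$ has at least $d$ nonfree coordinates. For $k\in\{1,\dots,d\}$ let $Q_k=T_k+Q$, where $T_k\in\mathbb{T}^\omega$ has $k$-th coordinate $(1-\varepsilon)|\pi_k(Q)|$ and all other coordinates $0$; here $\pi_k$ is the projection onto the $k$-th coordinate and $|\pi_k(Q)|$ is the length of $\pi_k(Q)\subset\mathbb{T}$. Then $\{Q_1,\dots,Q_d\}$ is called an $(\varepsilon,d)$-configuration around $Q$; an $(\varepsilon,d)$-configuration is an $(\varepsilon,d)$-configuration around some such $Q$. (The set $Q$ itself is not a member of the configuration.) Configurations $\mathcal{S}_j$ are called disjoint if the sets $\operatorname{sh}(\mathcal{S}_j):=\bigcup_{E\in\mathcal{S}_j}E$ are pairwise disjoint. Maximal operator. For a collection $\mathcal{B}$ of measurable sets of positive measure, $\mathcal{M}_{\mathcal{B}}f(x)=\sup_{B\in\mathcal{B},\,x\in B}\frac1{|B|}\int_B|f|\,dx$,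 with $\mathcal{M}_{\mathcal{B}}f(x)=0$ if no $B\in\mathcal{B}$ contains $x$. $\|\mathcal{M}_{\mathcal{B}}\|_{L^p\to L^{p,\infty}}$ is the smallest $K\in[0,\infty]$ such that $\lambda\,|\{\mathcal{M}_{\mathcal{B}}f>\lambda\}|^{1/p}\le K\|f\|_{L^p}$ for all $f\in L^p$ and $\lambda>0$. *)

(* Defs.v *)
From HB Require Import structures.
From mathcomp Require Import all_boot all_order all_algebra.
From mathcomp Require Import zify.
From mathcomp Require Import all_classical all_reals all_analysis.

Set Implicit Arguments.
Unset Strict Implicit.
Unset Printing Implicit Defensive.

Import Order.TTheory GRing.Theory Num.Theory.

Local Open Scope classical_set_scope.
Local Open Scope ring_scope.
Local Open Scope quotient_scope.

Section circle.
Context (R : realType).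

(* The set of integers, as a subgroup of R. *)
Definition int_subgroup : zmodClosed R :=
  GRing.ZmodClosed.clone R (@Num.int_num_subdef R) _.

Definition circle : Type := Quotient.quot int_subgroup.

HB.instance Definition _ := GRing.Zmodule.on circle.
HB.instance Definition _ := isPointed.Build circle 0.

Definition to_circle (x : R) : circle := \pi_(Quotient.quot int_subgroup) x.

Lemma to_circle_eq (x y : R) :
  (to_circle x == to_circle y) = (x - y \is a Num.int).
Proof. by rewrite /to_circle -Quotient.idealrBE. Qed.

Lemma to_circleD (x y : R) : to_circle (x + y) = to_circle x + to_circle y.
Proof. by rewrite /to_circle !piE. Qed.

(* A set is measurable when its 1-periodic lift is a Borel subset of R; these
   are exactly the Borel sets of the quotient topology. *)
Definition circle_measurable : set (set circle) :=
  [set A | measurable (to_circle @^-1` A)].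

Lemma circle_measurable0 : circle_measurable set0.
Proof. by rewrite /circle_measurable /= preimage_set0. Qed.

Lemma circle_measurableC (A : set circle) :
  circle_measurable A -> circle_measurable (~` A).
Proof. by rewrite /circle_measurable /= preimage_setC; exact: measurableC. Qed.

Lemma circle_measurable_bigcup (F : (set circle)^nat) :
  (forall i, circle_measurable (F i)) -> circle_measurable (\bigcup_i F i).
Proof.
rewrite /circle_measurable /= => mF; rewrite preimage_bigcup.
by apply: bigcupT_measurable.
Qed.

HB.instance Definition _ := @isMeasurable.Build default_measure_display circle
  circle_measurable circle_measurable0 circle_measurableC
  circle_measurable_bigcup.

Definition circle_length (A : set circle) : R :=
  fine (lebesgue_measure (to_circle @^-1` A `&` `[0, 1[ : set R)).

End circle.

Section torus.
Context (R : realType).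

(* Coordinates are numbered from 0: [x k] is the (k+1)-st coordinate of x. *)
Definition torus : Type := nat -> circle R.

HB.instance Definition _ := GRing.Zmodule.on torus.
HB.instance Definition _ := Pointed.on torus.

(* The product sigma-algebra, which is the Borel sigma-algebra of the product
   topology since the factors are second countable. *)
Definition torus_cylinders : set (set torus) :=
  [set A | exists (k : nat) (B : set (circle R)),
    measurable B /\ A = (fun x : torus => x k) @^-1` B].

Definition torus_measurable : set (set torus) := <<s torus_cylinders >>.

Lemma torus_measurable0 : torus_measurable set0.
Proof. exact: sigma_algebra0. Qed.

Lemma torus_measurableC (A : set torus) :
  torus_measurable A -> torus_measurable (~` A).
Proof. exact: sigma_algebraC. Qed.

Lemma torus_measurable_bigcup (F : (set torus)^nat) :
  (forall i, torus_measurable (F i)) -> torus_measurable (\bigcup_i F i).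
Proof. exact: sigma_algebra_bigcup. Qed.

HB.instance Definition _ := @isMeasurable.Build default_measure_display torus
  torus_measurable torus_measurable0 torus_measurableC torus_measurable_bigcup.

End torus.

Definition translate (V : zmodType) (t : V) (A : set V) : set V :=
  (fun x => t + x) @` A.

Definition is_haar (R : realType) (mu : probability (torus R) R) : Prop :=
  forall (t : torus R) (A : set (torus R)),
    measurable A -> mu (translate t A) = mu A.

(* [exponents m a]: a = (a_1, ..., a_N) is the list assigned to m >= 1. *)
Inductive exponents : nat -> seq nat -> Prop :=
| exponents_one : exponents 1 [:: 1%N]
| exponents_low n j : (1 <= n)%N -> (1 <= j <= n)%N ->
    exponents (n ^ 2 + j)%N (rcons (nseq n n) j)
| exponents_high n j : (1 <= n)%N -> (1 <= j <= n.+1)%N ->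
    exponents (n ^ 2 + n + j)%N (nseq j n.+1 ++ nseq (n.+1 - j) n).

Lemma exponents_unique (m : nat) :
  (0 < m)%N -> exists! a : seq nat, exponents m a.
Proof.
move=> m0.
have sqS n : (n.+1 ^ 2 = n ^ 2 + n + n.+1)%N by rewrite !expnS !expn0; nia.
have lin n k j l : (n ^ 2 + j = k ^ 2 + l -> 0 < j <= n + n.+1 ->
    0 < l <= k + k.+1 -> n = k /\ j = l)%N.
  move=> e hj hl; have /= := (sqS n, sqS k).
  case: (ltngtP n k) => [nk|kn|nk] [sn sk]; last by subst k; lia.
  - have : (n.+1 ^ 2 <= k ^ 2)%N by rewrite leq_sqr.
    lia.
  - have : (k.+1 ^ 2 <= n ^ 2)%N by rewrite leq_sqr.
    lia.
have ex : exists a, exponents m a.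
  have [->|m1] : m = 1%N \/ (1 < m)%N by lia.
    by exists [:: 1%N]; constructor.
  have [n [n1 nm]] : exists n, (1 <= n /\ n ^ 2 < m <= n.+1 ^ 2)%N.
    elim: m m1 {m0} => // m IH m1; have [m2|m2] : (m = 1 \/ 1 < m)%N by lia.
      by exists 1%N; rewrite m2.
    have [n [n1 nm]] := IH m2.
    have [?|?] : (m < n.+1 ^ 2 \/ m = n.+1 ^ 2)%N by lia.
      by exists n; lia.
    by exists n.+1; have := sqS n.+1; lia.
  have := sqS n => sn.
  have [?|?] : (m <= n ^ 2 + n \/ n ^ 2 + n < m)%N by lia.
    rewrite (_ : m = n ^ 2 + (m - n ^ 2))%N; last by lia.
    by eexists; apply: exponents_low; lia.
  rewrite (_ : m = n ^ 2 + n + (m - (n ^ 2 + n)))%N; last by lia.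
  by eexists; apply: exponents_high; lia.
have [a ha] := ex; exists a; split=> // b hb.
have sq1 n : (0 < n -> 0 < n ^ 2)%N by rewrite expn_gt0 => ->.
case: hb m0 ha {ex} => [|n j n1 j1|n j n1 j1] _ ha; inversion ha as
    [h1 h2|k l k1 l1 h1 h2|k l k1 l1 h1 h2] => //.
all: try have := sq1 _ n1; try have := sq1 _ k1; try by lia.
- move=> _ _; have [] : k = n /\ l = j by apply: lin; lia.
  by move=> -> ->.
- move=> _ _; suff [? ?] : k = n /\ (k + l = j)%N by lia.
  by apply: lin; lia.
- move=> _ _; suff [? ?] : k = n /\ (l = n + j)%N by lia.
  by apply: lin; lia.
- move=> _ _; have [kn lj] : k = n /\ (k + l = n + j)%N by apply: lin; lia.
  by rewrite kn (_ : l = j) //; lia.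
Qed.

Section configurations.
Context (R : realType).
Implicit Types (a : seq nat) (t : torus R) (Q : set (torus R)).

(* In V and H, a = (a_1, ..., a_N) is the list of exponents assigned to m, and
   N = size a is the number of nonfree coordinates. *)
Definition V a : set (torus R) :=
  [set x | forall i, (i < size a)%N ->
    (@to_circle R @` `]0, 2 ^- nth 0%N a i[) (x i)].

Definition H a : set (torus R) :=
  [set t | forall i, if (i < size a)%N
    then exists2 c : nat, (c < 2 ^ nth 0 a i)%N &
      t i = to_circle (c%:R * 2 ^- nth 0%N a i)
    else t i = 0].

Definition shift (eps : R) (k : nat) Q : torus R := fun i =>
  if i == k then
    to_circle ((1 - eps) * circle_length ((fun x : torus R => x k) @` Q))
  else 0.

Definition config_around (eps : R) (d : nat) Q : set (set (torus R)) :=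
  [set translate (shift eps k Q) Q | k in `I_d].

Definition is_config (eps : R) (d : nat) (S : set (set (torus R))) : Prop :=
  exists (m : nat) a t, [/\ exponents m a, H a t, (d <= size a)%N &
    S = config_around eps d (translate t (V a))].

Definition sh (S : set (set (torus R))) : set (torus R) := \bigcup_(E in S) E.

End configurations.

Section maximal.
Context (d : measure_display) (T : measurableType d) (R : realType).
Context (mu : {measure set T -> \bar R}).
Local Open Scope ereal_scope.

(* The averages are nonnegative, so [maxe 0] only matters when no member of BB
   contains x, where ereal_sup set0 = -oo. *)
Definition maximal (BB : set (set T)) (f : T -> R) (x : T) : \bar R :=
  maxe 0 (ereal_sup [set (mu B)^-1 * \int[mu]_(y in B) `|f y|%:E |
                      B in [set B | BB B /\ B x]]).

Definition weak_norm (p : R) (M : (T -> R) -> T -> \bar R) : \bar R :=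
  ereal_inf [set K | 0 <= K /\
    forall (f : T -> R) (lam : R), f \in Lfun mu p%:E -> (0 < lam)%R ->
      lam%:E * (mu [set x | lam%:E < M f x]) `^ p^-1
        <= K * 'N[mu]_p%:E[EFin \o f]].

End maximal.

(* Main.v *)
(* The shadows of the configurations are disjoint, so the weak-type bound may be
   proved for one configuration around Q at a time. If the averages over
   Q_1, ..., Q_n exceed lam and g is the sum of the indicators of the Q_k, then
   lam n |Q| < int |f| g, and Young's inequality reduces the claim to
   int g^q <= C^q (q / ln q)^q n |Q|. Off Q we have g <= 1, because any two
   distinct Q_k meet inside Q. On Q the events Q_k are independent of probability
   eps, so exponential moments of g are binomial: with L = n^(1/q) >= n eps and
   e^s = 1 + q / L, the bound x^q <= (q / (e s))^q e^(s x) gives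
   int_Q g^q <= (e q / s)^q |Q|, and s >= ln (1 + q) / L by Bernoulli. *)
Require Import Defs.
From mathcomp Require Import all_boot all_order all_algebra.
From mathcomp Require Import all_classical all_reals all_analysis.
From mathcomp Require Import measurable_realfun zify lra ring.

Set Implicit Arguments.
Unset Strict Implicit.
Unset Printing Implicit Defensive.

Import Order.TTheory GRing.Theory Num.Theory.
Local Open Scope classical_set_scope.
Local Open Scope ring_scope.

(** * Scalar inequalities and the exponential moment of the multiplicity *)

(** With [z = s x / q] this is the [q]-th power of the tangent-line inequality [z <= e^(z - 1)]. *)
Lemma powR_le_expR (R : realType) (q s x : R) : 0 < q -> 0 < s -> 0 <= x ->
  x `^ q <= (q / (expR 1 * s)) `^ q * expR (s * x).
Proof.
move=> q0 s0 x0; have e0 := expR_gt0 (1 : R).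
have es0 : 0 < expR 1 * s by exact: mulr_gt0.
have qes0 : 0 <= q / (expR 1 * s) by rewrite divr_ge0 ?ltW.
set z := s * x / q.
have -> : expR (s * x) = expR z `^ q.
  rewrite -expRM; congr expR; rewrite /z; field; rewrite gt_eqF//.
rewrite -powRM ?expR_ge0//; apply: ge0_ler_powR; rewrite ?nnegrE //; first exact: ltW.
  by apply: mulr_ge0 => //; exact: expR_ge0.
have -> : x = q / s * z by rewrite /z; field; rewrite !gt_eqF.
have -> : q / (expR 1 * s) * expR z = q / s * expR (z - 1).
  by rewrite expRB; field; rewrite !gt_eqF.
rewrite ler_pM2l ?divr_gt0//.
by have := expR_ge1Dx (z - 1); lra.
Qed.

(** Bernoulli's inequality [1 + L y <= (1 + y)^L] after a logarithm. It follows from Young's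
    inequality for the product of [(1 + L y)^(1/L)] and [1] with exponents [L] and [L / (L - 1)];
    the second exponent degenerates at [L = 1], which is treated apart. *)
Lemma ln1D_mul_le (R : realType) (L y : R) : 1 <= L -> 0 <= y ->
  ln (1 + L * y) <= L * ln (1 + y).
Proof.
move=> L1 y0; have L0 : 0 < L by lra.
have h : 1 + L * y <= (1 + y) `^ L.
  have [->|Ln1] := eqVneq L 1; first by rewrite powRr1; lra.
  have Lgt1 : 1 < L by rewrite lt_neqAle eq_sym Ln1.
  pose q := L / (L - 1).
  have Ly : 0 < 1 + L * y by have := mulr_ge0 (ltW L0) y0; lra.
  have := @conjugate_powR R ((1 + L * y) `^ L^-1) 1 L q (powR_ge0 _ _) ler01 L0.
  rewrite -powRrM mulVf ?gt_eqF// (powRr1 (ltW Ly)) powR1 mulr1 => h.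
  have LV : L - 1 != 0 by rewrite gt_eqF//; lra.
  have L1' : L != 0 by rewrite gt_eqF.
  have : (1 + L * y) `^ L^-1 <= 1 + y.
    rewrite (le_trans (h _ _))//.
    - by rewrite /q divr_gt0; lra.
    - by rewrite /q; field; apply/andP.
    - by rewrite /q le_eqVlt; apply/orP; left; apply/eqP; field; apply/andP.
  move=> /(ge0_ler_powR (ltW L0)); rewrite -powRrM mulVf ?gt_eqF// (powRr1 (ltW Ly)).
  by apply; rewrite nnegrE ?powR_ge0//; lra.
rewrite -ln_powR ler_ln ?posrE ?powR_gt0//; first by have := mulr_ge0 (ltW L0) y0; lra.
by lra.
Qed.

(* Writing e^(s 1_P) = 1 + (e^s - 1) 1_P and expanding the product. *)
Lemma expR_count (R : realType) (T : Type) (I : finType) (P : I -> set T)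
    (s : R) (x : T) :
  expR (s * \sum_i \1_(P i) x) =
  \sum_(J : {set I}) (expR s - 1) ^+ #|J| *
    \1_(\bigcap_(i in [set i | i \in J]) P i) x.
Proof.
rewrite mulr_sumr expR_sum.
transitivity (\prod_i ((expR s - 1) * \1_(P i) x + 1)).
  apply: eq_bigr => i _; rewrite indicE.
  by case: (x \in P i); rewrite /= ?(mulr1, mulr0) ?expR0; lra.
rewrite bigA_distr; apply: eq_bigr => J _.
rewrite -big_mkcond big_split /= prodr_const; congr (_ * _).
rewrite indicE; case: (pselect ((\bigcap_(i in [set i | i \in J]) P i) x)) => h.
  rewrite mem_set// big1// => i iJ; rewrite indicE mem_set//; exact: h.
rewrite memNset//; have /existsNP[i /not_implyP[/= iJ nPi]] := h.
by rewrite (bigD1 i)//= indicE memNset// mul0r.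
Qed.

(** The numerical end of the moment estimate. The summand [n] comes from integrating the constant 1
    over the union, the other summand from the exponential moment with [e^s = 1 + y]; [del] will be
    [2 * eps]. *)
Lemma moment_constant (R : realType) (n : nat) (q del : R) :
  (0 < n)%N -> 2 <= q -> 0 <= del -> n%:R * del <= 2 * n%:R `^ q^-1 ->
  let y := q / n%:R `^ q^-1 in
  n%:R + (q / (expR 1 * ln (1 + y))) `^ q * (1 + y * del) ^+ n
    <= n%:R * (2 * expR 1 * (q / ln q)) `^ q.
Proof.
move=> n0 q2 del0; set L := n%:R `^ q^-1 => ndel /=; set y := q / L.
have q0 : 0 < q by lra.
have e0 := expR_gt0 (1 : R).
have n1 : 1 <= n%:R :> R by rewrite ler1n.
have pow1 (r : R) : 1 `^ r = 1 :> R by rewrite powR1.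
have L1 : 1 <= L by rewrite -(pow1 q^-1) ge0_ler_powR ?nnegrE ?invr_ge0//; lra.
have L0 : 0 < L by lra.
have Lq : L `^ q = n%:R by rewrite /L -powRrM mulVf ?gt_eqF// powRr1; lra.
have lnq0 : 0 < ln q by rewrite ln_gt0; lra.
have y0 : 0 < y by rewrite divr_gt0.
have s0 : 0 < ln (1 + y) by rewrite ln_gt0; lra.
have lnqL : ln q <= L * ln (1 + y).
  apply: (le_trans _ (ln1D_mul_le L1 (ltW y0))).
  have -> : 1 + L * y = 1 + q by rewrite /y; field; rewrite gt_eqF.
  rewrite ler_ln ?posrE; lra.
set X := expR 1 * (q / ln q).
have X1 : 1 <= X.
  rewrite /X mulrA ler_pdivlMr// mul1r.
  have lnq : ln q <= q - 1.
    have q1 : -1 < q - 1 by lra.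
    by have := le_ln1Dx q1; rewrite (_ : 1 + (q - 1) = q)//; ring.
  apply: (le_trans lnq); have := expR_ge1Dx (1 : R) => e2.
  have : 2 * q <= expR 1 * q by rewrite ler_pM2r//; lra.
  lra.
have -> : 2 * expR 1 * (q / ln q) = 2 * X by rewrite /X; ring.
(* Here [(1 + y del)^n <= e^(y n del) <= e^(2 q)], because [y L = q]. *)
have expb : (1 + y * del) ^+ n <= (expR 2) `^ q.
  apply: (@le_trans _ _ (expR (y * del) ^+ n)).
    rewrite lerXn2r ?nnegrE ?expR_ge0 ?expR_ge1Dx//.
    by rewrite addr_ge0// mulr_ge0// ltW.
  rewrite -expRM_natl -expRM ler_expR.
  have -> : n%:R * (y * del) = y * (n%:R * del) by ring.
  apply: (le_trans (ler_wpM2l (ltW y0) ndel)).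
  by rewrite /y le_eqVlt; apply/orP; left; apply/eqP; field; rewrite gt_eqF.
(* Absorbing [e^(2 q)] into the power leaves [(e q / ln (1 + y))^q]. By [lnqL], [1 / ln (1 + y)] is
   at most [L / ln q], and [L^q = n]. *)
have Xq : (q / (expR 1 * ln (1 + y))) `^ q * (1 + y * del) ^+ n <= n%:R * X `^ q.
  apply: le_trans (ler_wpM2l (powR_ge0 _ _) expb) _.
  have es0 : 0 < expR 1 * ln (1 + y) by exact: mulr_gt0.
  have k0 : 0 < q / (expR 1 * ln (1 + y)) by exact: divr_gt0.
  have k2 := mulr_gt0 k0 (expR_gt0 2).
  have LX0 : 0 <= L * X by rewrite mulr_ge0//; lra.
  rewrite -(powRM _ (ltW k0) (expR_ge0 _)) -[n%:R]Lq -powRM; [|lra..].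
  apply: ge0_ler_powR; rewrite ?nnegrE//; [lra|exact: ltW|].
  have -> : expR 2 = expR 1 * expR 1 :> R by rewrite -expRD; congr expR; lra.
  have -> : q / (expR 1 * ln (1 + y)) * (expR 1 * expR 1) = expR 1 * (q / ln (1 + y)).
    by field; rewrite !gt_eqF.
  rewrite /X [leRHS]mulrCA ler_pM2l// [leRHS]mulrCA ler_pM2l//.
  by rewrite ler_pdivlMr// mulrC ler_pdivrMr.
(* Since [X >= 1], [n + n X^q <= 2 n X^q <= n (2 X)^q]; this is the source of the 2 in the final
   constant. *)
apply: (le_trans (lerD (lexx _) Xq)); rewrite -[leLHS]/(_ + _) powRM; [|lra..].
rewrite -[X in X + _]mulr1 -mulrDr ler_pM2l; last lra.
have Xq1 : 1 <= X `^ q by rewrite -(pow1 q) ge0_ler_powR ?nnegrE//; lra.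
have t2 : 2 <= 2 `^ q :> R by rewrite -[leLHS]powRr1// ler_powR; lra.
have := ler_wpM2r (ltW (lt_le_trans ltr01 Xq1)) t2; lra.
Qed.

(** On [Q] the sum over [J] is the expansion of [e^(s g)], where [g] is the multiplicity, and
    [powR_le_expR] applies. Off [Q] at most one [P i] contains [x], so [g^q <= 1], which the summand
    1 covers. *)
Lemma multiplicity_powR_le (R : realType) (T : Type) (I : finType)
    (Q : set T) (P : I -> set T) (q s : R) (x : T) :
  0 < q -> 0 < s -> (forall i j, i != j -> P i `&` P j `<=` Q) ->
  (\sum_i \1_(P i) x) `^ q <= 1 + (q / (expR 1 * s)) `^ q *
    \sum_(J : {set I}) (expR s - 1) ^+ #|J| *
      \1_(Q `&` \bigcap_(i in [set i | i \in J]) P i) x.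
Proof.
move=> q0 s0 PQ.
set k := (q / _) `^ q; have k0 : 0 <= k by exact: powR_ge0.
have es : 0 <= expR s - 1 by rewrite subr_ge0 ltW// expR_gt1.
have [Qx|nQx] := pselect (Q x).
  have -> : \sum_(J : {set I}) (expR s - 1) ^+ #|J| *
      \1_(Q `&` \bigcap_(i in [set i | i \in J]) P i) x =
      expR (s * \sum_i \1_(P i) x).
    rewrite expR_count; apply: eq_bigr => J _.
    by rewrite indicI /= [X in _ * (X * _)]indicE mem_set// mul1r.
  apply: le_trans (powR_le_expR q0 s0 _) _.
    by apply: sumr_ge0 => i _; rewrite indicE.
  by rewrite lerDr.
apply: (@le_trans _ _ 1); last first.
  rewrite lerDl mulr_ge0// sumr_ge0// => J _.
  by rewrite mulr_ge0 ?exprn_ge0// indicE.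
have g0 : 0 <= \sum_i \1_(P i) x :> R by apply: sumr_ge0 => i _; rewrite indicE.
have g1 : \sum_i \1_(P i) x <= 1 :> R.
  have [[i Pix]|nP] := pselect (exists i, P i x).
    rewrite (bigD1 i)//= big1 => [|j ji]; first by rewrite addr0 indicE mem_set.
    by rewrite indicE memNset// => Pjx; apply: nQx; apply: (PQ j i ji).
  by rewrite big1// => i _; rewrite indicE memNset// => Pix; apply: nP; exists i.
have := ge0_ler_powR (ltW q0) g0 ler01 g1; by rewrite powR1.
Qed.

(** * Weak-type estimate for a finite family in an abstract measure space *)

Section weak_type_of_a_family.
Context d (T : measurableType d) (R : realType).
Context (mu : {measure set T -> \bar R}).
Local Open Scope ereal_scope.

Lemma ge0_integral_sum_setU (I : finType) (P : I -> set T) (f : T -> \bar R) :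
  (forall i, measurable (P i)) -> measurable_fun [set: T] f -> (forall x, 0 <= f x) ->
  \sum_i \int[mu]_(x in P i) f x =
  \int[mu]_(x in \bigcup_i P i) (\sum_i (\1_(P i) x)%:E * f x).
Proof.
move=> mP mf f0.
have mU : measurable (\bigcup_i P i) by apply: fin_bigcup_measurable => // i _; exact: mP.
rewrite ge0_integral_sum//.
- apply: eq_bigr => i _.
  rewrite integral_mkcond [RHS]integral_mkcond; apply: eq_integral => x _.
  rewrite !patchE indicE; case: ifPn => xP.
    by rewrite mul1e mem_set//; exists i => //; exact: set_mem.
  by rewrite mul0e if_same.
- move=> i; apply: emeasurable_funM; last exact: measurable_funTS.
  by apply/measurable_EFinP; exact: measurable_indic.
- by move=> i x _; rewrite mule_ge0// lee_fin indicE.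
Qed.

Lemma measure_fin_bigcup_le (I : finType) (P : I -> set T) (w : R) :
  (forall i, measurable (P i)) -> (forall i, mu (P i) <= w%:E) ->
  mu (\bigcup_i P i) <= (#|I|%:R * w)%:E.
Proof.
move=> mP muP.
have mU : measurable (\bigcup_i P i).
  by apply: fin_bigcup_measurable => // i _; exact: mP.
rewrite -[mu _]mul1e -integral_cst//.
apply: (@le_trans _ _ (\int[mu]_(x in \bigcup_i P i) (\sum_i (\1_(P i) x)%:E * 1))).
  apply: ge0_le_integral => //.
    apply: emeasurable_sum => i; apply: emeasurable_funM => //.
    by apply/measurable_EFinP; exact: measurable_indic.
  move=> x [i _ Pix]; rewrite (bigD1 i)//= indicE mem_set// mul1e leeDl//.
  by apply: sume_ge0 => j _; rewrite mule1 lee_fin indicE.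
rewrite -(ge0_integral_sum_setU mP)//.
apply: (@le_trans _ _ (\sum_(i : I) w%:E)).
  by apply: lee_sum => i _; rewrite integral_cst// mul1e.
by rewrite sumEFin lee_fin sumr_const mulr_natl.
Qed.

(** Integrated term by term: the set [J] contributes at most [k (y del)^|J| w], and summing over all
    subsets gives back the product [(1 + y del)^|I|]. *)
Lemma integral_multiplicity_le (I : finType) (Q : set T) (P : I -> set T)
    (w k y del : R) :
  (forall i, measurable (P i)) -> measurable Q ->
  (forall i, mu (P i) <= w%:E) ->
  (forall J : {set I},
    mu (Q `&` \bigcap_(i in [set i | i \in J]) P i) <= (del ^+ #|J| * w)%:E) ->
  (0 <= k)%R -> (0 <= y)%R ->
  \int[mu]_(x in \bigcup_i P i) (1 + k * \sum_(J : {set I}) y ^+ #|J| *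
      \1_(Q `&` \bigcap_(i in [set i | i \in J]) P i) x)%:E
  <= ((#|I|%:R + k * (1 + y * del) ^+ #|I|) * w)%:E.
Proof.
move=> mP mQ muP muJ k0 y0.
have mU : measurable (\bigcup_i P i).
  by apply: fin_bigcup_measurable => // i _; exact: mP.
have mJ (J : {set I}) : measurable (Q `&` \bigcap_(i in [set i | i \in J]) P i).
  by apply: measurableI => //; apply: fin_bigcap_measurable => // i _; exact: mP.
have muU := measure_fin_bigcup_le mP muP.
have m1J (J : {set I}) : measurable_fun (\bigcup_i P i) (fun x =>
    (\1_(Q `&` \bigcap_(i in [set i | i \in J]) P i) x : R)%:E).
  by apply/measurable_EFinP; exact: measurable_indic.
have mkJ (J : {set I}) : measurable_fun (\bigcup_i P i) (fun x => (k * (y ^+ #|J| *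
    \1_(Q `&` \bigcap_(i in [set i | i \in J]) P i) x))%:E).
  by apply/measurable_EFinP; do 2 apply: measurable_funM => //; exact: measurable_indic.
have ky (J : {set I}) : (0 <= k * y ^+ #|J|)%R by rewrite mulr_ge0// exprn_ge0.
under eq_integral do rewrite EFinD mulr_sumr -sumEFin.
rewrite ge0_integralD//; last 2 first.
- move=> x _; apply: sume_ge0 => J _; rewrite lee_fin mulrA mulr_ge0// indicE.
- exact: emeasurable_sum.
rewrite ge0_integral_sum//; last first.
  by move=> J x _; rewrite lee_fin mulrA mulr_ge0// indicE.
rewrite integral_cst// mul1e mulrDl EFinD; apply: leeD => //.
apply: (@le_trans _ _ (\sum_(J : {set I}) (k * y ^+ #|J| * (del ^+ #|J| * w))%:E)).
  apply: lee_sum => J _; under eq_integral do rewrite mulrA EFinM.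
  have kyE : 0 <= (k * y ^+ #|J|)%:E by rewrite lee_fin ky.
  rewrite ge0_integralZl//.
  rewrite integral_indic// [leRHS]EFinM lee_wpmul2l//.
  apply: (le_trans _ (muJ J)); apply: le_measure; rewrite ?inE//.
  exact: measurableI.
rewrite sumEFin lee_fin (addrC 1%R).
have -> : ((y * del + 1) ^+ #|I| = \sum_(J : {set I}) (y * del) ^+ #|J|)%R.
  rewrite -prodr_const bigA_distr; apply: eq_bigr => J _.
  by rewrite -big_mkcond prodr_const.
rewrite mulr_sumr mulr_suml; apply: ler_sum => J _.
by rewrite exprMn !mulrA.
Qed.

(** Young's inequality is scaled so that the multiplicity term costs at most the fraction [1/q] of
    [lam |I| w]. That part is absorbed on the left, and the remaining fraction [1/p] is controlled
    by the integral of [|f|^p]. *)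
Lemma local_weak_type (I : finType) (Q : set T) (P : I -> set T) (w del p q : R)
    (f : T -> R) (lam : R) :
  (forall i, measurable (P i)) -> measurable Q ->
  (forall i, mu (P i) = w%:E) ->
  (forall i j, i != j -> P i `&` P j `<=` Q) ->
  (0 <= del)%R ->
  (forall J : {set I},
    mu (Q `&` \bigcap_(i in [set i | i \in J]) P i) <= (del ^+ #|J| * w)%:E) ->
  (2 <= q)%R -> (p^-1 + q^-1 = 1)%R ->
  (#|I|%:R * del <= 2 * #|I|%:R `^ q^-1)%R ->
  measurable_fun [set: T] f -> (0 < lam)%R ->
  (forall i, lam%:E < (mu (P i))^-1 * \int[mu]_(x in P i) `|f x|%:E) ->
  (lam `^ p)%:E * mu (\bigcup_i P i) <=
  ((2 * expR 1 * (q / ln q)) `^ p)%:E *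
    \int[mu]_(x in \bigcup_i P i) (`|f x| `^ p)%:E.
Proof.
move=> mP mQ muP PQ del0 muJ q2 pq ndel mf lam0 avg.
have mU : measurable (\bigcup_i P i).
  by apply: fin_bigcup_measurable => // i _; exact: mP.
have mfp (D : set T) : measurable_fun D (fun x => (`|f x| `^ p)%:E).
  apply/measurable_funTS/measurable_EFinP.
  by apply: (measurableT_comp (measurable_powR p)); exact: measurableT_comp.
have F0 : 0 <= \int[mu]_(x in \bigcup_i P i) (`|f x| `^ p)%:E.
  by apply: integral_ge0 => x _; rewrite lee_fin powR_ge0.
have [I0|I_gt0] := posnP #|I|.
  have U0 : \bigcup_i P i = set0 by apply: bigcup0 => i _; have := fintype0 i.
  by rewrite U0 measure0 integral_set0 !mule0.
have /card_gt0P[i0 _] := I_gt0.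
have w_ge0 : (0 <= w)%R by have : 0 <= mu (P i0) by []; rewrite muP lee_fin.
have q0 : (0 < q)%R by lra.
have lnq0 : (0 < ln q)%R by rewrite ln_gt0//; lra.
set B := (2 * expR 1 * (q / ln q))%R.
have B0 : (0 < B)%R.
  by rewrite mulr_gt0 ?divr_gt0// mulr_gt0// expR_gt0.
(* For [w = 0] the averages carry no usable information, but the union is then null. *)
have [w0|w_neq0] := eqVneq w 0%R.
  have muP' i : mu (P i) <= w%:E by rewrite muP.
  have := measure_fin_bigcup_le mP muP'.
  rewrite w0 mulr0 measure_le0 => /eqP ->.
  by rewrite mule0 mule_ge0// lee_fin powR_ge0.
have w_gt0 : (0 < w)%R by rewrite lt_neqAle eq_sym w_neq0.
have avg' i : (lam * w)%:E <= \int[mu]_(x in P i) `|f x|%:E.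
  have := avg i; rewrite muP inver (negbTE w_neq0) lte_pdivlMl// => /ltW.
  by rewrite -EFinM mulrC.
set L := (#|I|%:R `^ q^-1)%R in ndel.
set y := (q / L)%R.
have L0 : (0 < L)%R by rewrite powR_gt0// ltr0n.
have y0 : (0 < y)%R by rewrite divr_gt0.
have s0 : (0 < ln (1 + y))%R by rewrite ln_gt0//; lra.
have es : (expR (ln (1 + y)) - 1 = y)%R.
  by rewrite lnK ?posrE; [ring|lra].
set k := ((q / (expR 1 * ln (1 + y))) `^ q)%R.
have p0 : (0 < p)%R.
  have q1 : (q^-1 < 1)%R by rewrite invf_lt1//; lra.
  by rewrite -invr_gt0; lra.
pose h x : R := (1 + k * \sum_(J : {set I}) y ^+ #|J| *
      \1_(Q `&` \bigcap_(i in [set i | i \in J]) P i) x)%R.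
(* The coefficients of Young's inequality for the product of [(B / lam) |f|] and [g / B], multiplied
   through by [lam]; the left side is then [g |f|]. *)
pose c1 := (lam * (B / lam) `^ p / p)%R.
pose c2 := (lam * (B `^ q)^-1 / q)%R.
have c1_ge0 : (0 <= c1)%R by rewrite /c1 divr_ge0 ?mulr_ge0 ?powR_ge0// ltW.
have c2_ge0 : (0 <= c2)%R.
  by rewrite /c2 divr_ge0 ?mulr_ge0 ?invr_ge0 ?powR_ge0// ltW.
have h_ge0 x : (0 <= h x)%R.
  rewrite /h addr_ge0// mulr_ge0 ?powR_ge0// sumr_ge0// => J _.
  by rewrite mulr_ge0 ?exprn_ge0 ?(ltW y0)// indicE.
have mh : measurable_fun (\bigcup_i P i) (EFin \o h).
  apply/measurable_EFinP; apply: measurable_funD => //.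
  apply: measurable_funM => //; apply: measurable_sum => J.
  apply: measurable_funM => //; apply: measurable_indic.
  by apply: measurableI => //; apply: fin_bigcap_measurable => // i _; exact: mP.
have pointwise x : (\sum_i (\1_(P i) x * `|f x|) <= c1 * `|f x| `^ p + c2 * h x)%R.
  rewrite -mulr_suml; set g := (\sum_i _)%R.
  have g0 : (0 <= g)%R by apply: sumr_ge0 => i _; rewrite indicE.
  have gq : (g `^ q <= h x)%R.
    by rewrite /h -es; apply: multiplicity_powR_le.
  apply: (@le_trans _ _ (c1 * `|f x| `^ p + c2 * g `^ q)%R); last first.
    by rewrite lerD2l ler_wpM2l.
  have Bl0 : (0 <= B / lam)%R by rewrite divr_ge0// ltW.
  have BV0 : (0 <= B^-1)%R by rewrite invr_ge0 ltW.
  have f0 := normr_ge0 (f x).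
  have := conjugate_powR (mulr_ge0 Bl0 f0) (mulr_ge0 BV0 g0) p0 q0 pq.
  rewrite (powRM _ Bl0 f0) (powRM _ BV0 g0) => /(ler_wpM2l (ltW lam0)).
  have -> : (lam * (B / lam * `|f x| * (B^-1 * g)) = g * `|f x|)%R.
    by field; rewrite !gt_eqF.
  move=> /le_trans; apply; rewrite le_eqVlt; apply/orP; left; apply/eqP.
  have -> : (B^-1 `^ q = (B `^ q)^-1)%R.
    by rewrite -powR_inv1 ?(ltW B0)// -powRrM mulN1r powRN.
  by rewrite /c1 /c2; ring.
have : (\sum_(i : I) (lam * w)%:E) <=
    c1%:E * \int[mu]_(x in \bigcup_i P i) (`|f x| `^ p)%:E +
    c2%:E * \int[mu]_(x in \bigcup_i P i) (h x)%:E.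
  have mabs : measurable_fun [set: T] (fun x => `|f x|%:E).
    by apply/measurable_EFinP; exact: measurableT_comp.
  apply: (@le_trans _ _ (\sum_i \int[mu]_(x in P i) `|f x|%:E)).
    by apply: lee_sum => i _; exact: avg'.
  rewrite ge0_integral_sum_setU//.
  have pf0 x : (\bigcup_i P i) x -> 0 <= (`|f x| `^ p)%:E.
    by rewrite lee_fin powR_ge0.
  have h0 x : (\bigcup_i P i) x -> 0 <= (h x)%:E by rewrite lee_fin.
  have c1e : 0 <= c1%:E by rewrite lee_fin.
  have c2e : 0 <= c2%:E by rewrite lee_fin.
  have mc1 : measurable_fun (\bigcup_i P i) (fun x => c1%:E * (`|f x| `^ p)%:E).
    by apply: emeasurable_funM.
  have mc2 : measurable_fun (\bigcup_i P i) (fun x => c2%:E * (h x)%:E).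
    by apply: emeasurable_funM.
  rewrite -(ge0_integralZl mu mU (mfp _) pf0 c1e).
  rewrite -(ge0_integralZl mu mU mh h0 c2e).
  have pf1 x : (\bigcup_i P i) x -> 0 <= c1%:E * (`|f x| `^ p)%:E.
    by move=> Ux; rewrite mule_ge0// pf0.
  have h1 x : (\bigcup_i P i) x -> 0 <= c2%:E * (h x)%:E.
    by move=> Ux; rewrite mule_ge0// h0.
  rewrite -(ge0_integralD mu mU pf1 mc1 h1 mc2).
  apply: ge0_le_integral => //.
  - by move=> x _; apply: sume_ge0 => i _; rewrite mule_ge0// lee_fin indicE.
  - apply: emeasurable_sum => i; apply: emeasurable_funM; last exact: measurable_funTS.
    by apply/measurable_EFinP; exact: measurable_indic.
  - exact: emeasurable_funD.
  - move=> x _; have := pointwise x.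
    by rewrite -lee_fin EFinD !EFinM -sumEFin; under eq_bigr do rewrite EFinM.
have muP' i : mu (P i) <= w%:E by rewrite muP.
have hint : \int[mu]_(x in \bigcup_i P i) (h x)%:E <= (#|I|%:R * B `^ q * w)%:E.
  apply: le_trans (integral_multiplicity_le mP mQ muP' muJ (powR_ge0 _ _) (ltW y0)) _.
  rewrite lee_fin ler_wpM2r//; exact: (moment_constant I_gt0 q2 del0 ndel).
move=> /le_trans /(_ (leeD2l _ (lee_wpmul2l _ hint))).
rewrite lee_fin => /(_ c2_ge0).
have muU := measure_fin_bigcup_le mP muP'.
(* An infinite integral makes the bound trivial; a finite one allows the subtraction below. *)
move: F0; case: (\int[mu]_(x in _) (`|f x| `^ p)%:E) => [r| |]//= r0; last first.
  by move=> _; rewrite gt0_muley ?leey// lte_fin powR_gt0.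
rewrite sumEFin lee_fin sumr_const -[(_ *+ _)%R]mulr_natl => main.
apply: (@le_trans _ _ (lam `^ p * (#|I|%:R * w))%:E).
  by rewrite EFinM lee_wpmul2l// lee_fin powR_ge0.
rewrite -EFinM lee_fin.
have -> : (B `^ p = lam `^ p * (B / lam) `^ p)%R.
  rewrite -powRM ?(ltW lam0) ?divr_ge0 ?(ltW B0) ?(ltW lam0)//.
  by congr (_ `^ _)%R; field; rewrite gt_eqF.
rewrite -mulrA ler_wpM2l ?powR_ge0//.
(* The choice of [c2] turns [hint] into the bound [lam |I| w / q], which is moved to the left
   side. *)
have c2E : (c2 * (#|I|%:R * B `^ q * w) = lam * (#|I|%:R * w) * q^-1)%R.
  by rewrite /c2; field; rewrite !gt_eqF ?powR_gt0.
have c1E : (c1 * r = lam * p^-1 * ((B / lam) `^ p * r))%R by rewrite /c1; ring.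
rewrite c2E c1E in main.
have q1p : (q^-1 = 1 - p^-1)%R by rewrite -pq; ring.
rewrite q1p in main.
have lp0 : (0 < lam * p^-1)%R by rewrite mulr_gt0// invr_gt0.
by rewrite -(ler_pM2l lp0); lra.
Qed.

End weak_type_of_a_family.

(** * Arcs of the circle, boxes in the torus and their Haar measure *)

Section arcs_and_boxes.
Context (R : realType).
Implicit Types (u v tau ell : nat -> R) (N k : nat).

(** The endpoints are real lifts, so an arc may cross the point 0 of the circle, as a shifted side
    can. *)
Definition circle_arc (a b : R) : set (circle R) := @to_circle R @` `]a, b[.

Definition box N u v : set (torus R) :=
  [set x | forall i, (i < N)%N -> circle_arc (u i) (v i) (x i)].

Lemma to_circle_inj_lt1 (r s : R) :
  `|r - s| < 1 -> to_circle r = to_circle s -> r = s.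
Proof.
move=> rs1 /eqP; rewrite to_circle_eq => /intrP[m rsm].
move: rs1; rewrite rsm -intr_norm -[1]/(1%:~R) ltr_int => m1.
have m0 : m = 0 by lia.
by apply/eqP; rewrite -subr_eq0 rsm m0.
Qed.

Lemma to_circle0 : @to_circle R 0 = 0.
Proof. by apply: (addrI (to_circle 0)); rewrite -to_circleD !addr0. Qed.

Lemma to_circleN (x : R) : to_circle (- x) = - to_circle x.
Proof. by apply: (addrI (to_circle x)); rewrite -to_circleD !subrr to_circle0. Qed.

Lemma circle_arc_translate (a b r : R) (z : circle R) :
  circle_arc (a + r) (b + r) (to_circle r + z) <-> circle_arc a b z.
Proof.
split=> [[s]|[s]]; rewrite /= in_itv/= => /andP[as_ sb] sz.
- exists (s - r); first by rewrite /= in_itv/=; apply/andP; split; lra.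
  by rewrite to_circleD sz to_circleN addrAC subrr add0r.
- exists (s + r); first by rewrite /= in_itv/=; apply/andP; split; lra.
  by rewrite to_circleD sz addrC.
Qed.

(** The lift to the line is a union of integer translates of an open interval, hence open. *)
Lemma measurable_circle_arc (a b : R) : measurable (circle_arc a b).
Proof.
rewrite /measurable/= /circle_measurable/=.
have -> : @to_circle R @^-1` circle_arc a b =
    \bigcup_(m in [set: int]) `]a + m%:~R, b + m%:~R[%classic.
  apply/seteqP; split=> [r [s]|r [m _]]; rewrite /= in_itv/= => /andP[as_ sb].
    move=> /eqP; rewrite eq_sym to_circle_eq => /intrP[m rsm].
    by exists m => //; rewrite /= in_itv/=; apply/andP; split; lra.
  exists (r - m%:~R); first by rewrite /= in_itv/=; apply/andP; split; lra.
  apply/eqP; rewrite to_circle_eq; apply/intrP; exists (- m).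
  by rewrite mulrNz; ring.
apply: open_measurable; apply: bigcup_open => m _; exact: interval_open.
Qed.

Lemma measurable_box N u v : measurable (box N u v).
Proof.
have -> : box N u v =
    \bigcap_(i in `I_N) ((fun x : torus R => x i) @^-1` circle_arc (u i) (v i)).
  by [].
apply: fin_bigcap_measurable => // i _; apply: sub_sigma_algebra.
by exists i, (circle_arc (u i) (v i)); split => //; exact: measurable_circle_arc.
Qed.

Lemma translate_box N u v tau :
  translate (fun i => to_circle (tau i)) (box N u v) =
  box N (fun i => u i + tau i) (fun i => v i + tau i).
Proof.
apply/seteqP; split => [_ [x xb <-] i iN|x xb].
  by apply/circle_arc_translate; exact: xb.
exists (fun i => - to_circle (tau i) + x i).
  by move=> i iN; apply/(circle_arc_translate _ _ (tau i)); rewrite addNKr; exact: xb.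
by apply/funext => i; exact: addNKr.
Qed.

Context (mu : probability (torus R) R) (muH : is_haar mu).

Lemma haar_box_translate N u v tau :
  mu (box N (fun i => u i + tau i) (fun i => v i + tau i)) = mu (box N u v).
Proof. by rewrite -translate_box muH//; exact: measurable_box. Qed.

Definition set_coord k (c : R) u : nat -> R := fun i => if i == k then c else u i.

(* The M translates by multiples of eta of the slab of width eta at the end of
   side k are disjoint and fit in the box. *)
Lemma haar_box_pack N u v k (eta : R) (M : nat) :
  (k < N)%N -> 0 < eta -> v k - u k <= 1 -> M%:R * eta <= v k - u k ->
  (M%:R%:E * mu (box N (set_coord k (v k - eta) u) v) <= mu (box N u v))%E.
Proof.
move=> kN eta0 vu1 Meta.
pose F j := box N (set_coord k (v k - j.+1%:R * eta) u)
                  (set_coord k (v k - j%:R * eta) v).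
have mF j : measurable (F j) by exact: measurable_box.
have muF j : mu (F j) = mu (box N (set_coord k (v k - eta) u) v).
  rewrite -[RHS](haar_box_translate _ _ _ (fun i => if i == k then - (j%:R * eta) else 0)).
  congr (mu (box N _ _)); apply/funext => i; rewrite /set_coord /=.
  - by case: eqP => _; rewrite ?addr0// -natr1; ring.
  - by case: eqP => [->|_]; rewrite ?addr0.
have step (j M' : nat) : (j < M')%N -> j.+1%:R * eta <= M'%:R * eta.
  by move=> jM; rewrite ler_pM2r// ler_nat.
have F_disj : trivIset `I_M F.
  suff lt_disj i j x : (i < j)%N -> (j < M)%N -> F i x -> F j x -> False.
    move=> i j /= iM jM [x [Fi Fj]]; case: (ltngtP i j) => // ij.
      by case: (lt_disj i j x).
    by case: (lt_disj j i x).
  (* Along side [k] the slab [F i] lies above [F j]. The lifts [r] and [s] lie in an interval of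
     length at most 1, where equal images on the circle would force [r = s]. *)
  move=> ij jM /(_ k kN); rewrite /set_coord eqxx => -[r].
  rewrite /= in_itv/= => /andP[r1 r2] rx /(_ k kN); rewrite /set_coord eqxx => -[s].
  rewrite /= in_itv/= => /andP[s1 s2]; rewrite -rx => /to_circle_inj_lt1.
  have ij' := step _ _ ij; have jM' := step _ _ jM.
  have i0 : 0 <= i%:R * eta by rewrite mulr_ge0// ltW.
  have rs : s < r by lra.
  by rewrite ltr0_norm; lra.
have F_sub : \bigcup_(j in `I_M) F j `<=` box N u v.
  move=> x [j /= jM Fx] i iN; have := Fx i iN; rewrite /set_coord.
  case: eqP => [->|//] [r]; rewrite /= in_itv/= => /andP[r1 r2] rx.
  exists r => //; rewrite /= in_itv/=; have := step _ _ jM.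
  have j0 : 0 <= j%:R * eta by rewrite mulr_ge0// ltW.
  by move=> jM'; apply/andP; split; lra.
apply: (@le_trans _ _ (mu (\bigcup_(j in `I_M) F j))); last first.
  apply: le_measure; rewrite ?inE//; last exact: measurable_box.
  by apply: fin_bigcup_measurable => // j _; exact: mF.
rewrite measure_fin_bigcup// -fsbig_ord.
rewrite (eq_bigr _ (fun (j : 'I_M) _ => muF j)).
rewrite -(fineK (fin_num_measure mu _ (measurable_box N _ v))).
by rewrite sumEFin sumr_const card_ord -EFinM mulr_natl.
Qed.

(* The exact factor is eps ^+ size s; packing only floor(1/eps) slabs per side
   avoids computing Haar measures of boxes and costs 2 per side. *)
Lemma haar_box_shrink N u ell (eps : R) (s : seq nat) :
  (forall i, (i < N)%N -> 0 < ell i <= 1) -> 0 < eps <= 2^-1 ->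
  uniq s -> {in s, forall i, (i < N)%N} ->
  (mu (box N (fun i => if i \in s then u i + ell i - eps * ell i else u i)%R
             (fun i => u i + ell i)%R)
   <= ((2 * eps) ^+ size s)%:E * mu (box N u (fun i => u i + ell i)%R))%E.
Proof.
move=> ell01 /andP[eps0 eps2].
elim: s => [_ _|k s IH /= /andP[ks us] sN]; first by rewrite /= mul1e.
have kN : (k < N)%N by apply: sN; rewrite inE eqxx.
have {}IH := IH us (fun i is_ => sN i (mem_behead (s := k :: s) is_)).
have /andP[l0 l1] := ell01 k kN.
pose u' i := if i \in s then u i + ell i - eps * ell i else u i.
set M := Num.truncn eps^-1.
have eV2 : 2 <= eps^-1 by rewrite -[2]invrK lef_pV2// posrE; lra.
have Mle : M%:R <= eps^-1 by rewrite truncn_le; lra.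
have Mgt : eps^-1 < M.+1%:R by exact: truncnS_gt.
have eK : eps * eps^-1 = 1 by rewrite divff// gt_eqF.
have Meps : M%:R * eps <= 1.
  by rewrite -ler_pdivlMr// mul1r.
(* From [eps (M + 1) >= 1] and [eps <= 1/2] one gets [eps M >= 1/2]: rounding [1 / eps] down loses
   at most a factor 2. *)
have Meps2 : 1 <= 2 * eps * M%:R.
  have : eps * eps^-1 <= eps * M.+1%:R by rewrite ler_pM2l// ltW.
  rewrite -natr1; lra.
(* The packing takes place in the box already shrunk along [s]; as [k] is not in [s], its side [k]
   still has length [ell k]. *)
have := @haar_box_pack N u' (fun i => u i + ell i) k (eps * ell k) M kN.
have -> : set_coord k (u k + ell k - eps * ell k) u' =
    (fun i => if i \in k :: s then u i + ell i - eps * ell i else u i).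
  by apply/funext => i; rewrite /set_coord /u' inE; case: eqP => [->|].
have -> : u' k = u k by rewrite /u' (negbTE ks).
have -> : u k + ell k - u k = ell k by ring.
move=> /(_ (mulr_gt0 eps0 l0) l1).
have -> : M%:R * (eps * ell k) <= ell k by rewrite mulrA ger_pMl.
move=> /(_ isT); set a := mu _ => ab.
have ea : (a <= (2 * eps)%:E * (M%:R%:E * a))%E.
  rewrite muleA -EFinM -[leLHS]mul1e; apply: lee_wpmul2r; last by rewrite lee_fin.
  exact: measure_ge0.
apply: (le_trans ea).
have e2 : (0 <= (2 * eps)%:E)%E by rewrite lee_fin; lra.
apply: (le_trans (lee_wpmul2l e2 (le_trans ab IH))).
by rewrite exprS EFinM muleA.
Qed.

End arcs_and_boxes.

(** * Configurations as families of shifted boxes *)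

Section boxes.
Context (R : realType).
Implicit Types (u v tau ell : nat -> R) (N k : nat).

Definition side_box N u ell : set (torus R) := box N u (fun i => u i + ell i).

Definition bump_at (c : R) k ell : nat -> R := fun i => if i == k then c * ell i else 0.

(** The member of the configuration around [side_box N u ell] displaced in direction [k], written
    with real lifts. *)
Definition shifted_box N u ell (eps : R) k : set (torus R) :=
  side_box N (fun i => u i + bump_at (1 - eps) k ell i) ell.

(** With [0 <= a] and [b <= 1], no other integer translate of the interval meets [[0, 1[]. *)
Lemma circle_length_circle_arc (a b : R) : 0 <= a -> a < b -> b <= 1 ->
  circle_length (circle_arc a b) = b - a.
Proof.
move=> a0 ab b1; rewrite /circle_length.
have -> : @to_circle R @^-1` circle_arc a b `&` `[0, 1[ = `]a, b[%classic.
  apply/seteqP; split=> [s [[r]]|s] /=; rewrite !in_itv/=.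
    move=> /andP[ar rb] rs /andP[s0 s1].
    suff -> : s = r by rewrite ar rb.
    by apply/esym/to_circle_inj_lt1 => //; rewrite ltr_norml; apply/andP; split; lra.
  move=> /andP[as_ sb]; split; last by apply/andP; split; lra.
  by exists s => //; rewrite /= in_itv/= as_.
by rewrite lebesgue_measure_itv/= lte_fin ab -EFinB.
Qed.

Lemma image_side_box N u ell k :
  (k < N)%N -> (forall i, (i < N)%N -> 0 < ell i) ->
  (fun x : torus R => x k) @` side_box N u ell = circle_arc (u k) (u k + ell k).
Proof.
move=> kN ell0; apply/seteqP; split => [_ [x xb <-]|z kz]; first exact: xb.
(* The coordinates other than [k] are placed at the midpoints of their sides. *)
exists (fun i => if i == k then z else to_circle (u i + ell i / 2)); last first.
  by rewrite eqxx.
move=> i iN; case: eqP => [->//|_]; exists (u i + ell i / 2) => //.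
by rewrite /= in_itv/=; have := ell0 i iN => l0; apply/andP; split; lra.
Qed.

Lemma translate_shift_side_box N u ell (eps : R) k :
  (k < N)%N -> (forall i, (i < N)%N -> 0 < ell i) ->
  0 <= u k -> u k + ell k <= 1 ->
  translate (Defs.shift eps k (side_box N u ell)) (side_box N u ell) =
  shifted_box N u ell eps k.
Proof.
move=> kN ell0 u0 u1; have l0 := ell0 k kN.
have -> : Defs.shift eps k (side_box N u ell) =
    fun i => to_circle (bump_at (1 - eps) k ell i).
  apply/funext => i; rewrite /Defs.shift /bump_at; case: eqP => [->|_]; last first.
    by rewrite to_circle0.
  rewrite image_side_box// circle_length_circle_arc//; last by lra.
  by congr (to_circle (_ * _)); ring.
rewrite translate_box /shifted_box /side_box; congr box; apply/funext => i.
by rewrite addrAC.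
Qed.

Lemma exponents_gt0 m a : exponents m a -> forall i, (i < size a)%N -> (0 < nth 0 a i)%N.
Proof.
move=> ea i ia; suff : all (leq 1) a by move=> /(all_nthP 0%N); exact.
case: {i ia} ea => [//|n j n1 /andP[j1 _]|n j n1 _].
  by rewrite all_rcons j1 all_nseq n1 orbT.
by rewrite all_cat !all_nseq n1 !orbT.
Qed.

(** Passes from circle-valued data to real corners and side lengths. Sides are at most 1/2 because
    all exponents are positive; [shifted_box_sub] uses this bound to make lifts unique. *)
Lemma config_boxes (eps : R) d S : is_config eps d S ->
  exists N u ell, [/\ (d <= N)%N, forall i, (i < N)%N -> 0 < ell i <= 2^-1 &
    S = [set shifted_box N u ell eps k | k in `I_d]].
Proof.
move=> [m [a [t [ea Ht da ->]]]].
pose ell i : R := 2 ^- nth 0%N a i.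
have /choice[c cP] : forall i, exists c : nat, (i < size a)%N ->
    (c < 2 ^ nth 0 a i)%N /\ t i = to_circle (c%:R * ell i).
  move=> i; have := Ht i; case: ifP => ia; last by move=> _; exists 0%N.
  by move=> [c ? ?]; exists c.
pose u i : R := if (i < size a)%N then (c i)%:R * ell i else 0.
have ell0 i : 0 < ell i by rewrite invr_gt0 exprn_gt0.
exists (size a), u, ell; split=> //.
  move=> i ia; rewrite ell0 /ell lef_pV2 ?posrE ?exprn_gt0//.
  by rewrite -[leLHS]expr1 ler_weXn2l ?ler1n// (exponents_gt0 ea).
have -> : translate t (@V R a) = side_box (size a) u ell.
  have -> : t = fun i => to_circle (u i).
    apply/funext => i; rewrite /u; case: ifP => ia; first by have [] := cP i ia.
    by have := Ht i; rewrite ia to_circle0.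
  rewrite [@V R a](_ : _ = box (size a) (fun=> 0) ell)// translate_box.
  by congr box; apply/funext => i; rewrite ?add0r// addrC.
apply: eq_imagel => k /= kd; have ka := leq_trans kd da.
apply: translate_shift_side_box => //.
  by rewrite /u; case: ifP => // _; rewrite mulr_ge0// ltW.
(* From [c < 2^a] one gets [u + ell = (c + 1) 2^-a <= 1], so the side does not cross 0 and its
   circle length is [ell]. *)
rewrite /u ka -[X in _ + X]mul1r -mulrDl natr1 ler_pdivrMr ?exprn_gt0// mul1r.
by rewrite -natrX ler_nat; have [] := cP k ka.
Qed.

(** Each set is displaced in one coordinate only, so every coordinate is undisplaced in at least one
    of the two. *)
Lemma shifted_box_overlap N u ell (eps : R) i j : i != j ->
  shifted_box N u ell eps i `&` shifted_box N u ell eps j `<=` side_box N u ell.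
Proof.
move=> ij x [xi xj] l lN; have [li|li] := eqVneq l i.
  have := xj l lN; rewrite /bump_at li (negbTE ij) !addr0; exact.
by have := xi l lN; rewrite /bump_at (negbTE li) !addr0.
Qed.

(** In a coordinate of [s], membership in [Q] and in the shifted box gives two lifts, which differ
    by less than [2 ell <= 1] and hence agree. The common lift lies in the last [eps] fraction of
    the side. *)
Lemma shifted_box_sub N u ell (eps : R) (s : seq nat) :
  0 < eps <= 1 -> (forall i, (i < N)%N -> 0 < ell i <= 2^-1) ->
  side_box N u ell `&` \bigcap_(k in [set` s]) shifted_box N u ell eps k
  `<=` box N (fun i => if i \in s then u i + ell i - eps * ell i else u i)
             (fun i => u i + ell i).
Proof.
move=> /andP[eps0 eps1] ellP x [xQ xs] i iN; case: ifPn => [ia|_]; last exact: xQ.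
have [r] := xQ i iN; rewrite /= in_itv/= => /andP[r1 r2] rx.
have [s'] := xs i ia i iN; rewrite /= in_itv/= /bump_at eqxx => /andP[s1 s2] sx.
have /andP[l0 l1] := ellP i iN.
have el0 : 0 < eps * ell i by exact: mulr_gt0.
have ell_ : eps * ell i <= ell i by rewrite ger_pMl.
have srE : s' = r.
  apply: to_circle_inj_lt1; last by rewrite rx sx.
  by rewrite ltr_norml; apply/andP; split; lra.
by exists r => //; rewrite /= in_itv/= r2 andbT; lra.
Qed.

End boxes.

(** * Weak-type estimate for one configuration *)

Section weak_type.
Context (R : realType) (mu : probability (torus R) R) (muH : is_haar mu).
Local Open Scope ereal_scope.

Definition large_average (f : torus R -> R) (lam : R) (E : set (torus R)) : bool :=
  lam%:E < (mu E)^-1 * \int[mu]_(y in E) `|f y|%:E.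

Lemma config_measurable (eps : R) d S E :
  is_config eps d S -> S E -> measurable E.
Proof.
by move=> /config_boxes[N [u [ell [_ _ ->]]]] [k _ <-]; exact: measurable_box.
Qed.

Lemma config_finite (eps : R) d S : is_config eps d S -> finite_set S.
Proof.
by move=> /config_boxes[N [u [ell [_ _ ->]]]]; exact: finite_image.
Qed.

Lemma config_weak_type (eps : R) d S (p q : R) (f : torus R -> R) (lam : R) :
  (0 < eps <= 2^-1)%R -> is_config eps d S ->
  (2 <= q)%R -> (p^-1 + q^-1 = 1)%R -> (eps * d%:R `^ p^-1 <= 1)%R ->
  measurable_fun [set: torus R] f -> (0 < lam)%R ->
  let U := \bigcup_(E in S `&` large_average f lam) E in
  (lam `^ p)%:E * mu U <=
    ((2 * expR 1 * (q / ln q)) `^ p)%:E * \int[mu]_(x in U) (`|f x| `^ p)%:E.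
Proof.
move=> epsP /config_boxes[N [u [ell [dN ellP ->]]]] q2 pq epsd mf lam0; cbv zeta.
set U := \bigcup_(E in _) E.
have /andP[eps0 eps2] := epsP.
(* Only the members with large average are kept, so the family may have fewer than [d] sets. *)
pose I : finType := {k : 'I_d | large_average f lam (shifted_box N u ell eps k)}.
pose P (i : I) := shifted_box N u ell eps (val i).
have iN (i : I) : (val i < N)%N by exact: leq_trans (ltn_ord _) dN.
have ellP1 i : (i < N)%N -> (0 < ell i <= 1)%R.
  by move=> /ellP/andP[l0 l1]; rewrite l0; lra.
have UE : U = \bigcup_i P i.
  apply/seteqP; split=> [x [_ [[k /= kd <-] avg] kx]|x [i _ Pix]].
    by exists (exist _ (Ordinal kd) avg).
  exists (P i) => //; split; last exact: (valP i).
  by exists (val i) => //=; exact: ltn_ord.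
have mQ : measurable (side_box N u ell) by exact: measurable_box.
have muQ : mu (side_box N u ell) = (fine (mu (side_box N u ell)))%:E.
  by rewrite fineK// fin_num_measure.
have muP i : mu (P i) = (fine (mu (side_box N u ell)))%:E.
  rewrite -muQ [RHS](esym (haar_box_translate muH N u _ (bump_at (1 - eps) (val i) ell))).
  by congr (mu (box _ _ _)); apply/funext => l; exact: addrAC.
(* Here [w] is the measure of [Q], shared by all its translates, and [del = 2 * eps] is the factor
   per direction in [haar_box_shrink]. *)
rewrite UE; apply: (@local_weak_type _ _ _ mu I (side_box N u ell) P
  (fine (mu (side_box N u ell))) (2 * eps)) => //.
- by move=> i; exact: measurable_box.
- move=> i j ij; apply: shifted_box_overlap; apply: contra ij => /eqP ij.
  by apply/eqP; do 2 apply: val_inj.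
- by rewrite mulr_ge0// ltW.
- move=> J; pose s := [seq nat_of_ord (val i) | i <- enum J].
  have us : uniq s.
    by rewrite map_inj_uniq ?enum_uniq// => i j ij; do 2 apply: val_inj.
  have sN : {in s, forall i, (i < N)%N} by move=> _ /mapP[i _ ->].
  have := haar_box_shrink muH u ellP1 epsP us sN.
  rewrite size_map -cardE -/(side_box N u ell) EFinM -muQ; apply: le_trans.
  apply: le_measure; rewrite ?inE; last 2 first.
  + exact: measurable_box.
  + apply: subset_trans (shifted_box_sub _ ellP); last by rewrite eps0; lra.
    apply: setIS => x Px k /= /mapP[i]; rewrite mem_enum => iJ ->; exact: Px.
  apply: measurableI => //; apply: fin_bigcap_measurable => // i _.
  exact: measurable_box.
(* With [n = |I| <= d], write [n eps = n^(1/q) (eps n^(1/p))]; the last factor is at most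
   [eps d^(1/p) <= 1]. *)
- rewrite mulrCA ler_pM2l//.
  have -> : (#|I|%:R * eps = #|I|%:R `^ q^-1 * (eps * #|I|%:R `^ p^-1))%R.
    rewrite mulrCA -powRD; last by rewrite addrC pq oner_eq0.
    by rewrite addrC pq powRr1// mulrC.
  rewrite -[leRHS]mulr1 ler_wpM2l ?powR_ge0//; apply: le_trans epsd.
  rewrite ler_pM2l// ge0_ler_powR ?nnegrE ?ler_nat//.
    have : (q^-1 <= 1)%R by rewrite invf_le1; lra.
    by rewrite -pq lerDr.
  by rewrite card_sig (leq_trans (max_card _))// card_ord.
- by move=> i; exact: (valP i).
Qed.

End weak_type.

(** * From single configurations to the weak norm of the maximal operator *)

(** As [lam > 0], the default value 0 in [maximal] never exceeds [lam], and a supremum exceeds [lam]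
    exactly when some average does. *)
Lemma superlevel_maximal (R : realType) (mu : probability (torus R) R)
    (BB : set (set (torus R))) (f : torus R -> R) (lam : R) : 0 < lam ->
  [set x | (lam%:E < maximal mu BB f x)%E] =
  \bigcup_(E in BB `&` large_average mu f lam) E.
Proof.
move=> lam0; apply/seteqP; split=> [x /=|x [E [BE avg] Ex]].
  rewrite /maximal lt_max lte_fin => /orP[lam_lt0|/ereal_sup_gt[_ [E [BE Ex] <-]] avg].
    by have := lt_trans lam0 lam_lt0; rewrite ltxx.
  by exists E.
rewrite /= /maximal lt_max; apply/orP; right.
by apply: (lt_le_trans avg); apply: ereal_sup_ubound; exists E.
Qed.

(** The definition asks for the [p]-th root of this inequality. In [p]-th powers both sides are
    additive over disjoint sets, which suits the summation over configurations. *)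
Lemma weak_norm_le d (T : measurableType d) (R : realType)
    (mu : {measure set T -> \bar R}) (p K : R) (M : (T -> R) -> T -> \bar R) :
  0 < p -> 0 <= K ->
  (forall (f : T -> R) (lam : R), measurable_fun [set: T] f -> 0 < lam ->
    ((lam `^ p)%:E * mu [set x | lam%:E < M f x]
      <= (K `^ p)%:E * \int[mu]_x (`|f x| `^ p)%:E)%E) ->
  (weak_norm mu p M <= K%:E)%E.
Proof.
move=> p0 K0 weak; apply: ereal_inf_lbound; split; first by rewrite lee_fin.
move=> f lam fL lam0.
have mf : measurable_fun [set: T] f by have := sub_Lfun_mfun fL; rewrite inE.
have pN0 : p != 0 by rewrite gt_eqF.
have rootK (x : \bar R) : (0 <= x)%E -> ((x `^ p) `^ p^-1 = x)%E.
  by move=> x0; rewrite -poweRrM mulfV// poweRe1.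
have root_scale (c : R) (x : \bar R) : 0 <= c -> (0 <= x)%E ->
    (((c `^ p)%:E * x) `^ p^-1 = c%:E * x `^ p^-1)%E.
  move=> c0 x0; rewrite poweRM//; last by rewrite lee_fin powR_ge0.
  by rewrite -poweR_EFin rootK// lee_fin.
have F0 : (0 <= \int[mu]_x (`|f x| `^ p)%:E)%E.
  by apply: integral_ge0 => x _; rewrite lee_fin powR_ge0.
have -> : ('N[mu]_p%:E[EFin \o f] = (\int[mu]_x (`|f x| `^ p)%:E) `^ p^-1)%E.
  by rewrite -[LHS]rootK ?Lnorm_ge0// poweR_Lnorm.
rewrite -!root_scale ?(ltW lam0)//.
apply: gt0_ler_poweR; last exact: weak.
- by rewrite invr_ge0 ltW.
- by rewrite in_itv/= leey andbT mule_ge0// lee_fin powR_ge0.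
- by rewrite in_itv/= leey andbT mule_ge0// lee_fin powR_ge0.
Qed.

Theorem corollary1p4 (R : realType) :
  exists2 C : R, 0 < C &
  forall (mu : probability (torus R) R) (J : set nat)
    (eps : nat -> R) (d : nat -> nat) (S : nat -> set (set (torus R))) (p0 : R),
  is_haar mu ->
  (forall j, J j -> 0 < eps j <= 2^-1) ->
  (forall j, J j -> (0 < d j)%N) ->
  (forall j, J j -> is_config (eps j) (d j) (S j)) ->
  trivIset J (fun j => sh (S j)) ->
  1 < p0 <= 2 ->
  ereal_sup [set (eps j * (d j)%:R `^ p0^-1)%:E | j in J] = 1%E ->
  let q0 := p0 / (p0 - 1) in
  (weak_norm mu p0 (maximal mu (\bigcup_(j in J) S j))
     <= (C * (q0 / ln q0))%:E)%E.
Proof.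
(* The value [2 e] is inherited from [moment_constant]. *)
exists (2 * expR 1); first by rewrite mulr_gt0// expR_gt0.
move=> mu J eps d S p muH epsP d0 confS disjS /andP[p1 p2] Ap1 /=; set q := p / (p - 1).
have p_gt0 : 0 < p by lra.
have p1_gt0 : 0 < p - 1 by lra.
have q2 : 2 <= q by rewrite ler_pdivlMr//; lra.
have pq : p^-1 + q^-1 = 1 by rewrite /q; field; rewrite !gt_eqF.
have K0 : 0 <= 2 * expR 1 * (q / ln q).
  have lnq : 0 <= ln q by rewrite ln_ge0//; lra.
  by apply: mulr_ge0; [rewrite mulr_ge0// expR_ge0 | rewrite divr_ge0//; lra].
apply: weak_norm_le => // f lam mf lam0.
rewrite (superlevel_maximal _ _ _ lam0).
(* Setting [U j] empty outside [J] lets the series run over all of [nat]. *)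
pose U j := if j \in J then
  \bigcup_(E in S j `&` large_average mu f lam) E else set0.
have -> : \bigcup_(E in (\bigcup_(j in J) S j) `&` large_average mu f lam) E =
    \bigcup_j U j.
  apply/seteqP; split=> [x [E [[j Jj SE] avg] Ex]|x [j _]].
    by exists j => //; rewrite /U mem_set//; exists E.
  rewrite /U; case: ifPn => [/set_mem Jj|//] [E [SE avg] Ex].
  by exists E => //; split => //; exists j.
have mU j : measurable (U j).
  rewrite /U; case: ifPn => [/set_mem Jj|_]; last exact: measurable0.
  apply: fin_bigcup_measurable => [|E [SE _]].
    by apply: sub_finite_set (config_finite (confS j Jj)); exact: subIsetl.
  exact: config_measurable (confS j Jj) SE.
have U_disj : trivIset [set: nat] U.
  move=> i j _ _; rewrite /U; case: ifPn => [/set_mem Ji|_]; last by move=> [? []].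
  case: ifPn => [/set_mem Jj|_]; last by move=> [? []].
  move=> [x [[E [SE _] Ex] [E' [SE' _] Ex']]]; apply: (disjS i j) => //.
  by exists x; split; [exists E|exists E'].
have mfp : measurable_fun [set: torus R] (fun x => (`|f x| `^ p)%:E).
  apply/measurable_EFinP.
  by apply: (measurableT_comp (measurable_powR p)); exact: measurableT_comp.
have fp0 (x : torus R) : (0 <= (`|f x| `^ p)%:E)%E by rewrite lee_fin powR_ge0.
have mUU : measurable (\bigcup_j U j) by exact: bigcupT_measurable.
have lamp : (0 <= (lam `^ p)%:E)%E by rewrite lee_fin powR_ge0.
have Kp : (0 <= ((2 * expR 1 * (q / ln q)) `^ p)%:E)%E by rewrite lee_fin powR_ge0.
have local j : ((lam `^ p)%:E * mu (U j) <=
    ((2 * expR 1 * (q / ln q)) `^ p)%:E * \int[mu]_(x in U j) (`|f x| `^ p)%:E)%E.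
  rewrite /U; case: ifPn => [/set_mem Jj|_]; last first.
    by rewrite measure0 integral_set0 !mule0.
  apply: config_weak_type (confS j Jj) _ _ _ _ _ => //; first exact: epsP.
  rewrite -lee_fin -[1%:E]Ap1; apply: ereal_sup_ubound; by exists j.
apply: (@le_trans _ _ (\sum_(0 <= j <oo) (lam `^ p)%:E * mu (U j))%E).
  rewrite nneseriesZl//; apply: lee_wpmul2l => //.
  exact: measure_sigma_subadditive.
apply: (@le_trans _ _ (\sum_(0 <= j <oo) ((2 * expR 1 * (q / ln q)) `^ p)%:E *
    \int[mu]_(x in U j) (`|f x| `^ p)%:E)%E).
  by apply: lee_nneseries => // j _; rewrite mule_ge0.
rewrite nneseriesZl//; last by move=> j _; exact: integral_ge0.
apply: lee_wpmul2l => //.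
(* Disjoint shadows make the integrals over the [U j] add up to a single one over their union, which
   the integral over the whole torus dominates. *)
rewrite -ge0_integral_bigcup//; last exact: measurable_funTS.
exact: ge0_subset_integral.
Qed.
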